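(* Suppose that $x\ge0$ for all $x\in\mathcal X$, the nonnegativity being among the constraints defining $\mathcal X$. Let $$z^{\mathrm{QP}}=\min_{x\in\mathcal X}\{x^\top\bar Q^0x+c_0^\top x+d_0:\ x^\top\bar Q^kx+c_k^\top x+d_k\le0,\ k=1,\dots,m\},$$ $$z^{\mathrm{SDP}}=\min_{Y\in\mathcal Y}\{Q^0\bullet Y:\ Q^k\bullet Y\le0,\ k=1,\dots,m;\ Y\in\mathcal S^+\},$$ $$z^{\mathrm{DNN}}=\min_{Y\in\mathcal Y}\{Q^0\bullet Y:\ Q^k\bullet Y\le0,\ k=1,\dots,m;\ Y\in\mathcal D\},$$ $$z^{\mathrm{SDP\text{-}E}}=\min_{Y\in\mathcal Y}\{Q^0\bullet Y:\ Q^k\bullet Y\le0,\ k=1,\dots,m;\ C\bullet Y\ge0\ \forall C\in\mathcal S^+\cap\mathcal S(E);\ Y_{ij}=0\ \forall(i,j)\notin E\},$$ $$z^{\mathrm{DNN\text{-}E}}=\min_{Y\in\mathcal Y}\{Q^0\bullet Y:\ Q^k\bullet Y\le0,\ k=1,\dots,m;\ C\bullet Y\ge0\ \forall C\in\mathcal D^*\cap\mathcal S(E);\ Y_{ij}\ge0\ \forall(i,j)\in E;\ Y_{ij}=0\ \forall(i,j)\notin E\}.$$ Then $$z^{\mathrm{QP}}\ \ge\ z^{\mathrm{DNN}}\ =\ z^{\mathrm{DNN\text{-}E}}\ \ge\ z^{\mathrm{SDP\text{-}E}}\ =\ z^{\mathrm{SDP}}.$$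
   Context: All matrices named without a bar are real symmetric of size $(n+1)\times(n+1)$ with rows and columns indexed by $0,1,\dots,n$. $\mathcal S$ is the space of such matrices, $\mathcal S^+\subset\mathcal S$ the cone of positive semidefinite ones, and $A\bullet B=\operatorname{tr}(B^\top A)$. $\mathcal D=\mathcal S^+\cap\mathbb R_{\ge0}^{(n+1)\times(n+1)}$ is the doubly nonnegative cone and $\mathcal D^*=\mathcal S^++\mathbb R_{\ge0}^{(n+1)\times(n+1)}$ (second summand: symmetric entrywise nonnegative matrices) is its dual cone in $\mathcal S$. Data: for $k=0,\dots,m$, a symmetric $n\times n$ matrix $\bar Q^k$ (not assumed positive semidefinite), $c_k\in\mathbb R^n$, $d_k\in\mathbb R$, and $Q^k=\begin{bmatrix} d_k & \tfrac12 c_k^\top\\ \tfrac12 c_k & \bar Q^k\end{bmatrix}\in\mathcal S$. A set $\mathcal X\subseteq\mathbb R^n$ encodes simple linear or bound constraints. The sparsity pattern is $$E=\{(i,j)\in\{0,\dots,n\}^2: i=0\text{ or }j=0\text{ or }i=j\text{ or }Q^k_{ij}\ne0\text{ for some }k\in\{0,\dots,m\}\},$$ and $\mathcal S(E)=\{Y\in\mathcal S: Y_{ij}=0\ \forall (i,j)\notin E\}$. $\mathcal Y$ is the set of $Y\in\mathcal S$ with $Y_{00}=1$ and $(Y_{10},\dots,Y_{n0})^\top\in\mathcal X$. It may in addition include finitely many linear inequality constraints on $Y$ whose coefficient matrices lie in $\mathcal S(E)$ and which are valid for the original problem, i.e. satisfied by $\begin{bmatrix} 1 \\ x \end{bmatrix}\begin{bmatrix}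 1 \\ x \end{bmatrix}^\top$ for every feasible $x$ of the problem defining $z^{\mathrm{QP}}$. Optimal values are understood as infima in $[-\infty,+\infty]$. *)

(* Defs.v *)
From HB Require Import structures.
From mathcomp Require Import all_boot all_order all_algebra.
From mathcomp Require Import all_classical all_reals all_analysis.
Set Implicit Arguments.
Unset Strict Implicit.
Unset Printing Implicit Defensive.
Import Order.TTheory GRing.Theory Num.Theory.
Local Open Scope classical_set_scope.
Local Open Scope ring_scope.

(* Matrices of size n + 1 have type 'M[R]_(1 + n), so that index 0 is the
   homogenizing coordinate and the block operations of matrix.v split it off. *)

Section Cones.
Variables (R : realType) (N : nat).
Implicit Types A B : 'M[R]_N.

Definition mxinner A B : R := \tr (B^T *m A).

Definition psd_cone : set 'M[R]_N :=
  [set A | A \is symmetricmx /\ forall v : 'cV[R]_N, 0 <= (v^T *m A *m v) 0 0].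

Definition nonneg_cone : set 'M[R]_N :=
  [set A | A \is symmetricmx /\ forall i j, 0 <= A i j].

Definition dnn_cone : set 'M[R]_N := psd_cone `&` nonneg_cone.

Definition dnn_dual_cone : set 'M[R]_N :=
  [set A | exists P T, [/\ psd_cone P, nonneg_cone T & A = P + T]].

Definition sparse_mx (E : rel 'I_N) : set 'M[R]_N :=
  [set A | A \is symmetricmx /\ forall i j, ~~ E i j -> A i j = 0].

End Cones.

Section Problems.
Variables (R : realType) (n m : nat).

(* The objective has index ord0; the constraints have indices 0 < k. *)
Section Original.
Variables (Qbar : 'I_m.+1 -> 'M[R]_n) (c : 'I_m.+1 -> 'cV[R]_n).
Variables (d : 'I_m.+1 -> R) (X : set 'cV[R]_n).

Definition quad (k : 'I_m.+1) (x : 'cV[R]_n) : R :=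
  (x^T *m Qbar k *m x) 0 0 + ((c k)^T *m x) 0 0 + d k.

Definition qp_feasible : set 'cV[R]_n :=
  [set x | X x /\ forall k : 'I_m.+1, (0 < k)%N -> quad k x <= 0].

Definition zQP : \bar R := ereal_inf [set (quad ord0 x)%:E | x in qp_feasible].

Definition homQ (k : 'I_m.+1) : 'M[R]_(1 + n) :=
  block_mx (d k)%:M (2^-1 *: (c k)^T) (2^-1 *: c k) (Qbar k).

End Original.

Definition rank1_lift (x : 'cV[R]_n) : 'M[R]_(1 + n) :=
  col_mx 1%:M x *m (col_mx 1%:M x)^T.

Section Relaxations.
Variable Q : 'I_m.+1 -> 'M[R]_(1 + n).

Definition sparsity : rel 'I_(1 + n) := fun i j =>
  [|| i == ord0, j == ord0, i == j | [exists k, Q k i j != 0]].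

(* X is the ground set for x; the p additional valid inequalities on Y are
   B l . Y <= b l. *)
Variables (X : set 'cV[R]_n) (p : nat).
Variables (B : 'I_p -> 'M[R]_(1 + n)) (b : 'I_p -> R).

Definition lifted_set : set 'M[R]_(1 + n) :=
  [set Y : 'M[R]_(1 + n) | [/\ Y \is symmetricmx, Y ord0 ord0 = 1, X (dlsubmx Y)
             & forall l, mxinner (B l) Y <= b l]].

Definition zlift (K : set 'M[R]_(1 + n)) : \bar R :=
  ereal_inf [set (mxinner (Q ord0) Y)%:E | Y in
    [set Y | [/\ lifted_set Y,
                 forall k : 'I_m.+1, (0 < k)%N -> mxinner (Q k) Y <= 0
               & K Y]]].

Definition zSDP : \bar R := zlift (@psd_cone R (1 + n)).

Definition zDNN : \bar R := zlift (@dnn_cone R (1 + n)).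

Definition zSDPE : \bar R := zlift
  [set Y | (forall C, (@psd_cone R (1 + n) `&` sparse_mx sparsity) C ->
              0 <= mxinner C Y)
        /\ (forall i j, ~~ sparsity i j -> Y i j = 0)].

Definition zDNNE : \bar R := zlift
  [set Y | [/\ forall C, (@dnn_dual_cone R (1 + n) `&` sparse_mx sparsity) C ->
                 0 <= mxinner C Y,
               forall i j, sparsity i j -> 0 <= Y i j
             & forall i j, ~~ sparsity i j -> Y i j = 0]].

End Relaxations.

End Problems.

(* Main.v *)
Require Import Defs.
From HB Require Import structures.
From mathcomp Require Import all_boot all_order all_algebra.
From mathcomp Require Import all_classical all_reals all_analysis.
From mathcomp Require Import ring lra.
Set Implicit Arguments.
Unset Strict Implicit.
Unset Printing Implicit Defensive.
Import Order.TTheory GRing.Theory Num.Theory.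
Import numFieldNormedType.Exports.
Local Open Scope classical_set_scope.
Local Open Scope ring_scope.

(** The objective and all constraints of the relaxations read only the entries
of Y indexed by the sparsity pattern E.  The two equalities therefore reduce to
a statement about partial matrices: symmetric data Y on E extend to a matrix of
the cone K (positive semidefinite, resp. doubly nonnegative) as soon as
C . Y >= 0 for every C in the dual cone of K supported on E.  In the other
direction one just zeroes the entries off E; the tests then hold because two
positive semidefinite matrices have a nonnegative inner product
([psd_inner_ge0]).

The completion is found by one minimization instead of a separation argument
([penalized_completion]).  Over all positive semidefinite Z, minimize the sum of
the squared residuals Z_ij - Y_ij on E and r(Z_ij) off E, where r = 0 for the
semidefinite cone, and r(z) = min(z, 0) for the doubly nonnegative one.  A
minimizer exists: E contains the diagonal, so a bounded penalty bounds the
diagonal of Z and hence all its entries ([psd_penalty_minimizer]).  The matrix G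
of residuals at the minimizer is half the gradient of the penalty; stationarity
in the directions of the cone and in the direction - Z says that G is positive
semidefinite and that G . Z <= 0 ([residual_first_order]).  The part C of G
supported on E is an admissible test matrix: it is G itself when r = 0, and
when r(z) = min(z, 0) it is G plus the nonnegative matrix - r(Z_ij) off E.
Finally the minimal penalty equals G . Z - C . Y, which is at most 0, so every
residual vanishes, and Z is the completion wanted.

The inequality with the original problem comes from the rank one matrices
(1, x)(1, x)^T, which are doubly nonnegative when x >= 0, and the one between
the two sparse relaxations from the inclusion of the semidefinite cone in the
dual of the doubly nonnegative one. *)

(** * Quadratic forms and the semidefinite cone *)

Section Quadratic.
Variables (R : realType) (N : nat).
Implicit Types (A B : 'M[R]_N) (u v : 'cV[R]_N).

Definition bilin A u v : R := (u^T *m A *m v) 0 0.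

Lemma symmxP A : reflect (forall i j, A i j = A j i) (A \is symmetricmx).
Proof.
rewrite is_hermitianmxE expr0 scale1r map_mx_id //.
apply: (iffP eqP) => [AE i j|AE]; first by rewrite {1}AE mxE.
by apply/matrixP => i j; rewrite mxE.
Qed.

Lemma mxinnerE A B : mxinner A B = \sum_i \sum_j A i j * B i j.
Proof.
rewrite /mxinner /mxtrace exchange_big /=; apply: eq_bigr => j _.
by rewrite mxE; apply: eq_bigr => i _; rewrite mxE mulrC.
Qed.

Lemma bilinE A u v : bilin A u v = \sum_i \sum_j u i 0 * v j 0 * A i j.
Proof.
rewrite /bilin mxE exchange_big /=; apply: eq_bigr => j _.
rewrite mxE big_distrl; apply: eq_bigr => i _ /=; rewrite mxE; ring.
Qed.

Lemma mxinner_rank1 A v : mxinner A (v *m v^T) = bilin A v v.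
Proof.
rewrite mxinnerE bilinE; apply: eq_bigr => i _; apply: eq_bigr => j _.
by rewrite mxE big_ord1 !mxE mulrC.
Qed.

Lemma bilin_delta_l A i v : bilin A (delta_mx i 0) v = (A *m v) i 0.
Proof. by rewrite /bilin trmx_delta -mulmxA -rowE mxE. Qed.

Lemma bilin_delta A i j : bilin A (delta_mx i 0) (delta_mx j 0) = A i j.
Proof. by rewrite bilin_delta_l -colE mxE. Qed.

Lemma bilin_sym A u v : A \is symmetricmx -> bilin A u v = bilin A v u.
Proof.
move=> /symmxP As; rewrite !bilinE exchange_big /=.
by apply: eq_bigr => i _; apply: eq_bigr => j _; rewrite As; ring.
Qed.

Lemma bilin_addZ A u v (t : R) : A \is symmetricmx ->
  bilin A (u + t *: v) (u + t *: v)
  = bilin A u u + 2 * t * bilin A v u + t ^+ 2 * bilin A v v.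
Proof.
move=> As.
have -> : bilin A (u + t *: v) (u + t *: v)
  = bilin A u u + t * bilin A v u + t * bilin A u v + t * t * bilin A v v.
  rewrite /bilin.
  have -> : (u + t *: v)^T = u^T + t *: v^T by rewrite linearD linearZ.
  rewrite !mulmxDl !mulmxDr -!scalemxAl -!scalemxAr.
  by rewrite !mxE /=; ring.
rewrite (bilin_sym u v As); ring.
Qed.

(** Evaluate the quadratic form at the vectors e_i + e_j and e_i - e_j. *)
Lemma psd_offdiag A i j : psd_cone A -> `|A i j| <= (A i i + A j j) / 2.
Proof.
move=> [As A0]; have /symmxP Asym := As.
have q t : 0 <= A i i + 2 * t * A j i + t ^+ 2 * A j j.
  by rewrite -!bilin_delta -bilin_addZ //; exact: A0.
have := q 1; have := q (-1); rewrite (Asym i j) ler_norml; lra.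
Qed.

Lemma psd_diag_ge0 A i : psd_cone A -> 0 <= A i i.
Proof. by move=> [_ /(_ (delta_mx i 0))]; rewrite -/(bilin _ _ _) bilin_delta. Qed.

Lemma psd_rank1 v : psd_cone (v *m v^T).
Proof.
split; first by apply/symmxP => i j; rewrite !mxE !big_ord1 !mxE mulrC.
move=> u; have -> : u^T *m (v *m v^T) *m u = (v^T *m u)^T *m (v^T *m u).
  by rewrite trmx_mul trmxK !mulmxA.
by rewrite mxE big_ord1 mxE -expr2 sqr_ge0.
Qed.

Lemma psdD A B : psd_cone A -> psd_cone B -> psd_cone (A + B).
Proof.
move=> [/symmxP As A0] [/symmxP Bs B0]; split.
  by apply/symmxP => i j; rewrite !mxE As Bs.
by move=> v; rewrite mulmxDr mulmxDl mxE addr_ge0.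
Qed.

Lemma psdZ (t : R) A : 0 <= t -> psd_cone A -> psd_cone (t *: A).
Proof.
move=> t0 [/symmxP As A0]; split.
  by apply/symmxP => i j; rewrite !mxE As.
by move=> v; rewrite -scalemxAr -scalemxAl mxE mulr_ge0.
Qed.

Lemma psd0 : psd_cone (0 : 'M[R]_N).
Proof.
by split=> [|v]; [apply/symmxP => i j; rewrite !mxE | rewrite mulmx0 mul0mx mxE].
Qed.

End Quadratic.

(** * Self-duality of the semidefinite cone *)

Section Fejer.
Variables (R : realType) (N : nat).
Implicit Types (A B P Z : 'M[R]_N).

(** The Schur complement of the diagonal entry k, kept at the size of A: row and
column k become zero. *)
Definition schur_compl A (k : 'I_N) : 'M[R]_N :=
  A - (A k k)^-1 *: (col k A *m (col k A)^T).

Lemma schurE A k i j : schur_compl A k i j = A i j - A i k * A j k / A k k.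
Proof. by rewrite /schur_compl !mxE big_ord1 !mxE mulrC. Qed.

(** Completing the square: the form of the complement at u is the form of A at the
vector that minimizes it on the line u + R e_k. *)
Lemma psd_schur A k : psd_cone A -> A k k != 0 -> psd_cone (schur_compl A k).
Proof.
move=> [As A0] akk; have /symmxP Asym := As.
split; first by apply/symmxP => i j; rewrite !schurE (Asym i j); ring.
move=> u; rewrite -/(bilin _ _ _).
have colu : (col k A)^T *m u = (bilin A (delta_mx k 0) u)%:M.
  rewrite bilin_delta_l; apply/matrixP => i j.
  rewrite !ord1 mxE [RHS]mxE eqxx mulr1n mxE; apply: eq_bigr => l _.
  by rewrite !mxE Asym.
have -> : bilin (schur_compl A k) u u
    = bilin A u u - (A k k)^-1 * bilin A (delta_mx k 0) u ^+ 2.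
  rewrite /bilin /schur_compl mulmxBr mulmxBl -scalemxAr -scalemxAl.
  rewrite mxE; congr (_ + _); rewrite mxE; congr (- _).
  rewrite mxE; congr (_ * _).
  have -> : u^T *m (col k A *m (col k A)^T) *m u
      = ((col k A)^T *m u)^T *m ((col k A)^T *m u).
    by rewrite trmx_mul trmxK !mulmxA.
  by rewrite -/(bilin _ _ _) colu tr_scalar_mx -scalar_mxM mxE eqxx mulr1n expr2.
have := A0 (u + (- (bilin A (delta_mx k 0) u / A k k)) *: delta_mx k 0).
rewrite -/(bilin _ _ _) bilin_addZ // bilin_delta => h; apply: le_trans h _.
by rewrite le_eqVlt; apply/orP; left; apply/eqP; field.
Qed.

(** Fejer's inequality.  Splitting off the Schur complement of a nonzero diagonal
entry leaves a rank one term, whose inner product with Z is a value of the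
quadratic form of Z; the complement has strictly fewer nonzero diagonal
entries, and a semidefinite matrix with zero diagonal is zero. *)
Lemma psd_inner_ge0 P Z : psd_cone P -> psd_cone Z -> 0 <= mxinner P Z.
Proof.
move=> + Zpsd; have [s] := ubnP #|[set i | P i i != 0]%SET|.
elim: s P => // s IHs P; rewrite ltnS => les Ppsd.
have [k|P0] := pickP (fun k => P k k != 0); last first.
  rewrite mxinnerE big1 // => i _; rewrite big1 // => j _.
  have /eqP Pii := negbFE (P0 i); have /eqP Pjj := negbFE (P0 j).
  have := psd_offdiag i j Ppsd; rewrite Pii Pjj addr0 mul0r normr_le0 => /eqP ->.
  by rewrite mul0r.
move=> Pkk; have P'psd := psd_schur Ppsd Pkk.
have -> : mxinner P Z
    = mxinner (schur_compl P k) Z + (P k k)^-1 * bilin Z (col k P) (col k P).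
  rewrite bilinE !mxinnerE big_distrr -big_split; apply: eq_bigr => i _ /=.
  rewrite big_distrr -big_split; apply: eq_bigr => j _ /=.
  by rewrite schurE !mxE; ring.
apply: addr_ge0; last first.
  by apply: mulr_ge0; [rewrite invr_ge0; exact: psd_diag_ge0|exact: (proj2 Zpsd)].
apply: IHs => //; apply: leq_trans les; apply: proper_card.
apply/properP; split; last first.
  by exists k; rewrite !inE // negbK schurE mulfK // subrr.
(* If P i i = 0, the i-th diagonal entry of the complement is
   - P i k ^+ 2 / P k k, which is nonnegative only if it is zero. *)
apply/fintype.subsetP => i; rewrite !inE; apply: contraNN => /eqP Pii.
have := psd_diag_ge0 i P'psd; rewrite schurE Pii sub0r oppr_ge0 => h.
rewrite eq_le oppr_le0 oppr_ge0 h andbT.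
by rewrite mulr_ge0 ?invr_ge0 ?psd_diag_ge0 // -expr2 sqr_ge0.
Qed.

Lemma psd_self_dual P : P \is symmetricmx ->
  (forall Z, psd_cone Z -> 0 <= mxinner P Z) -> psd_cone P.
Proof.
move=> Ps P0; split=> // v; rewrite -/(bilin _ _ _) -mxinner_rank1 P0 //.
exact: psd_rank1.
Qed.

End Fejer.

(** * Minimizing a penalty over the semidefinite cone *)

Section Minimization.
Variables (R : realType) (N : nat).
Implicit Types (A B C G W Y Z : 'M[R]_N).

(** Compactness is used in the space of row vectors, so that matrices are flattened
by [mxvec]. *)
Lemma vec_mx_coord_continuous (i j : 'I_N) :
  continuous (fun v : 'rV[R]_(N * N) => vec_mx v i j).
Proof.
have -> : (fun v : 'rV[R]_(N * N) => vec_mx v i j)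
  = (fun v : 'rV[R]_(N * N) => v 0 (mxvec_index i j)).
  by apply/funext => v; rewrite mxE.
exact: coord_continuous.
Qed.

Lemma continuous_sum2 (F : 'I_N -> 'I_N -> 'rV[R]_(N * N) -> R) :
  (forall i j, continuous (F i j)) ->
  continuous (fun v => \sum_i \sum_j F i j v).
Proof.
move=> cF; apply: continuous_big => [|i _]; first exact: add_continuous.
by apply: continuous_big => [|j _]; [exact: add_continuous|exact: cF].
Qed.

Lemma closed_psd : closed [set v : 'rV[R]_(N * N) | psd_cone (vec_mx v)].
Proof.
pose D i j := fun v : 'rV[R]_(N * N) => vec_mx v i j - vec_mx v j i.
have cD i j : continuous (D i j).
  by move=> v; apply: continuousB; exact: vec_mx_coord_continuous.
have cq (u : 'cV[R]_N) :
    continuous (fun v : 'rV[R]_(N * N) => bilin (vec_mx v) u u).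
  have -> : (fun v : 'rV[R]_(N * N) => bilin (vec_mx v) u u)
    = (fun v : 'rV[R]_(N * N) => \sum_i \sum_j u i 0 * u j 0 * vec_mx v i j).
    by apply/funext => v; rewrite bilinE.
  apply: continuous_sum2 => i j v.
  apply: (@continuousM R _ (fun=> u i 0 * u j 0)
           (fun v : 'rV[R]_(N * N) => vec_mx v i j)).
    exact: cst_continuous.
  exact: vec_mx_coord_continuous.
have -> : [set v : 'rV[R]_(N * N) | psd_cone (vec_mx v)] =
  (\bigcap_(ij in [set: 'I_N * 'I_N]) (D ij.1 ij.2 @^-1` [set x | 0 <= x])) `&`
  \bigcap_(u in [set: 'cV[R]_N])
    ((fun v : 'rV[R]_(N * N) => bilin (vec_mx v) u u) @^-1` [set x | 0 <= x]).
  apply/seteqP; split=> v /=.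
    move=> [/symmxP vs v0]; split; last by move=> u _; exact: v0.
    by move=> [i j] _ /=; rewrite /D vs subrr.
  move=> [vs v0]; split; last by move=> u; exact: v0.
  apply/symmxP => i j; apply/eqP; rewrite eq_le -subr_ge0 -[X in _ && X]subr_ge0.
  by rewrite (vs (j, i)) // (vs (i, j)).
apply: closedI; apply: closed_bigI => x _.
  by apply: preimage_closed; [move=> v _; exact: cD|exact: closed_ge].
by apply: preimage_closed; [move=> v _; exact: cq|exact: closed_ge].
Qed.

(** The diagonal penalties alone make the sublevel sets bounded, since the diagonal
of a semidefinite matrix dominates its other entries; the off-diagonal
penalties may even vanish. *)
Lemma psd_penalty_minimizer (phi : 'I_N -> 'I_N -> R -> R) (y : 'I_N -> R) :
  (forall i j, continuous (phi i j)) -> (forall i j z, 0 <= phi i j z) ->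
  (forall i z, phi i i z = (z - y i) ^+ 2) ->
  exists2 Z, psd_cone Z & forall W, psd_cone W ->
    \sum_i \sum_j phi i j (Z i j) <= \sum_i \sum_j phi i j (W i j).
Proof.
move=> phi_cont phi_ge0 phi_diag.
pose f W := \sum_i \sum_j phi i j (W i j).
have f_diag W i : (W i i - y i) ^+ 2 <= f W.
  rewrite -phi_diag /f (bigD1 i) //= (bigD1 i) //= -addrA lerDl addr_ge0 //.
    by apply: sumr_ge0.
  by apply: sumr_ge0 => k _; apply: sumr_ge0.
have f0_ge0 : 0 <= f 0 by apply: sumr_ge0 => i _; apply: sumr_ge0.
(* From (z - y)^2 <= s follows z <= y + s + 1. *)
pose M := \sum_i `|y i| + f 0 + 1.
have bounded W : psd_cone W -> f W <= f 0 -> forall i j, `|W i j| <= M.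
  move=> Wpsd fW i j; apply: le_trans (psd_offdiag i j Wpsd) _.
  have WM k : W k k <= M.
    have yk : y k <= \sum_i `|y i|.
      rewrite (bigD1 k) //=; apply: le_trans (ler_norm _) _.
      by rewrite lerDl sumr_ge0.
    have := le_trans (f_diag W k) fW; rewrite /M; nra.
  have := WM i; have := WM j; lra.
pose K := [set v : 'rV[R]_(N * N) | psd_cone (vec_mx v)] `&`
  [set v : 'rV[R]_(N * N) | forall k, `[- M, M]%classic (v 0 k)].
have compactK : compact K.
  rewrite /K setIC; apply: compact_closedI; last exact: closed_psd.
  by apply: (@rV_compact _ _ (fun=> `[- M, M]%classic)) => k; exact: segment_compact.
have inK W : psd_cone W -> f W <= f 0 -> K (mxvec W).
  move=> Wpsd fW; split; first by rewrite /= mxvecK.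
  move=> k; case/mxvec_indexP: k => i j; rewrite mxvecE /= in_itv /=.
  by rewrite -ler_norml bounded.
have [||v /set_mem[vpsd _] vmin] :=
    @compact_EVT_min _ R (fun v => f (vec_mx v)) K _ compactK.
- by exists (mxvec 0); apply: inK => //; exact: psd0.
- apply: continuous_subspaceT; apply: continuous_sum2 => i j v.
  apply: (@continuous_comp _ _ _ (fun v : 'rV[R]_(N * N) => vec_mx v i j) (phi i j)).
    exact: vec_mx_coord_continuous.
  exact: phi_cont.
exists (vec_mx v) => // W Wpsd; rewrite -!/(f _).
have [fW|/ltW fW] := leP (f W) (f 0).
  by have := vmin (mxvec W); rewrite mxvecK; apply; apply/mem_set/inK.
apply: le_trans fW.
by have := vmin (mxvec 0); rewrite mxvecK; apply; apply/mem_set/inK => //; exact: psd0.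
Qed.

End Minimization.

(** * Completion of partial matrices *)

Section Completion.
Variables (R : realType) (N : nat).
Implicit Types (A B C D G W Y Z : 'M[R]_N).

(** The residuals z - y, 0 and min(z, 0) are the differences between z and its
projection onto a closed convex subset of the line ({y}, the whole line, the
half-line of nonnegative reals).  The inequality holds since the projection of
z is a competitor for the distance of z + h; it replaces the derivative of the
squared distance in first-order conditions. *)
Definition residual (r : R -> R) : Prop :=
  continuous r /\
  forall z h, r (z + h) ^+ 2 <= r z ^+ 2 + 2 * r z * h + h ^+ 2.

Lemma residual_sub (y : R) : residual (fun z => z - y).
Proof.
split=> [z|z h]; last nra.
by apply: continuousB; [exact: cvg_id|exact: cst_continuous].
Qed.

Lemma residual_zero : residual (fun=> 0 : R).
Proof. by split=> [|z h]; [exact: cst_continuous|nra]. Qed.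

Lemma residual_neg : residual (fun z : R => Num.min z 0).
Proof.
split=> [|z h].
  have := @min_fun_continuous _ R R id (fun=> 0).
  by apply; [move=> z; exact: cvg_id|exact: cst_continuous].
rewrite !minEle; case: ifPn; case: ifPn; rewrite -?ltNge; nra.
Qed.

(** Along Z + t D the penalty is at most its value at Z plus 2 t G . D + t^2 D . D,
where G is the matrix of residuals; a negative G . D would let it decrease for
small t > 0. *)
Lemma residual_first_order (rho : 'I_N -> 'I_N -> R -> R) Z D :
  (forall i j, residual (rho i j)) ->
  (forall W, psd_cone W ->
    \sum_i \sum_j rho i j (Z i j) ^+ 2 <= \sum_i \sum_j rho i j (W i j) ^+ 2) ->
  (forall t, 0 <= t <= 1 -> psd_cone (Z + t *: D)) ->
  0 <= mxinner (\matrix_(i, j) rho i j (Z i j)) D.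
Proof.
move=> rhoP Zmin Zdir; set g := mxinner _ _; rewrite leNgt; apply/negP => g0.
pose q := mxinner D D.
have q0 : 0 <= q.
  rewrite /q mxinnerE; apply: sumr_ge0 => i _; apply: sumr_ge0 => j _.
  by rewrite -expr2 sqr_ge0.
have key t : 0 <= t <= 1 -> 0 <= 2 * t * g + t ^+ 2 * q.
  move=> /Zdir/Zmin Zt.
  rewrite -(lerD2l (\sum_i \sum_j rho i j (Z i j) ^+ 2)) addr0.
  apply: le_trans Zt _.
  rewrite /g /q !mxinnerE !big_distrr -!big_split ler_sum // => i _ /=.
  rewrite !big_distrr -!big_split ler_sum // => j _ /=.
  rewrite !mxE; have [_ /(_ (Z i j) (t * D i j))] := rhoP i j; nra.
(* This step lies in ]0, 1] and satisfies t * q < - g. *)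
pose t := - g / (q + 1 - g).
have d0 : 0 < q + 1 - g by lra.
have tE : t * (q + 1 - g) = - g by rewrite /t mulfVK // gt_eqF.
have t0 : 0 < t by rewrite /t divr_gt0 ?oppr_gt0.
have /key : 0 <= t <= 1 by rewrite ltW //= /t ler_pdivrMr //; lra.
nra.
Qed.

Definition mask (E : rel 'I_N) G : 'M[R]_N :=
  \matrix_(i, j) if E i j then G i j else 0.

Lemma mxinner_agree (E : rel 'I_N) C Y Z : sparse_mx E C ->
  (forall i j, E i j -> Y i j = Z i j) -> mxinner C Y = mxinner C Z.
Proof.
move=> [_ C0] YZ; rewrite !mxinnerE.
apply: eq_bigr => i _; apply: eq_bigr => j _.
by have [/YZ ->//|/C0 ->] := boolP (E i j); rewrite !mul0r.
Qed.

Lemma mask_agree (E : rel 'I_N) G i j : E i j -> mask E G i j = G i j.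
Proof. by rewrite mxE => ->. Qed.

Lemma mask_sparse (E : rel 'I_N) G : symmetric E -> G \is symmetricmx ->
  sparse_mx E (mask E G).
Proof.
move=> Es /symmxP Gs; split; first by apply/symmxP => i j; rewrite !mxE Es Gs.
by move=> i j /negbTE Eij; rewrite mxE Eij.
Qed.

(** The common core of both completion theorems.  The hypothesis on r z * z
expresses that r is the residual of a projection onto a cone; it makes the
minimal penalty equal to G . Z - (mask E G) . Y, where G, the matrix of residuals
at the minimizer Z, has G . Z <= 0. *)
Lemma penalized_completion (E : rel 'I_N) (r : R -> R) Y :
  symmetric E -> reflexive E -> Y \is symmetricmx ->
  residual r -> (forall z, r z * z = r z ^+ 2) ->
  (forall G, psd_cone G -> (forall i j, ~~ E i j -> exists z, G i j = r z) ->
     0 <= mxinner (mask E G) Y) ->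
  exists Z, [/\ psd_cone Z, forall i j, E i j -> Z i j = Y i j
    & forall i j, ~~ E i j -> r (Z i j) = 0].
Proof.
move=> Es Er /symmxP Ys rP rE test.
pose rho i j := if E i j then fun z => z - Y i j else r.
have rhoP i j : residual (rho i j).
  by rewrite /rho; case: ifP => _ //; exact: residual_sub.
have [|||Z Zpsd Zmin] :=
    @psd_penalty_minimizer R N (fun i j z => rho i j z ^+ 2) (fun i => Y i i).
- move=> i j z; apply: (@continuous_comp _ _ _ (rho i j) (fun x => x ^+ 2)).
    exact: (proj1 (rhoP i j)).
  exact: exprn_continuous.
- by move=> i j z; exact: sqr_ge0.
- by move=> i z; rewrite /rho Er.
have /symmxP Zs := Zpsd.1.
pose G : 'M[R]_N := \matrix_(i, j) rho i j (Z i j).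
have Gpsd : psd_cone G.
  apply: psd_self_dual => [|W Wpsd].
    by apply/symmxP => i j; rewrite !mxE /rho Es Ys Zs.
  apply: residual_first_order => // t /andP[t0 _].
  by apply: psdD => //; exact: psdZ.
have GZ : mxinner G Z <= 0.
  have : 0 <= mxinner G (- Z).
    apply: residual_first_order => // t /andP[_ t1].
    rewrite scalerN -scaleNr -{1}[Z]scale1r -scalerDl.
    by apply: psdZ => //; rewrite subr_ge0.
  rewrite !mxinnerE -oppr_ge0 -sumrN => h; apply: le_trans h _.
  apply: ler_sum => i _; rewrite -sumrN; apply: ler_sum => j _.
  by rewrite !mxE mulrN.
have GY : 0 <= mxinner (mask E G) Y.
  apply: test => // i j Eij; exists (Z i j).
  by rewrite mxE /rho (negbTE Eij).
have /eqP : \sum_i \sum_j rho i j (Z i j) ^+ 2 = 0.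
  apply/eqP; rewrite eq_le; apply/andP; split; last first.
    by apply: sumr_ge0 => i _; apply: sumr_ge0 => j _; exact: sqr_ge0.
  have -> : \sum_i \sum_j rho i j (Z i j) ^+ 2 = mxinner G Z - mxinner (mask E G) Y.
    rewrite !mxinnerE -sumrB; apply: eq_bigr => i _.
    rewrite -sumrB; apply: eq_bigr => j _.
    by rewrite !mxE /rho; case: ifP => _; [ring|rewrite mul0r subr0 rE].
  by rewrite subr_le0; apply: le_trans GY.
rewrite psumr_eq0 => [|i _]; last by apply: sumr_ge0 => j _; exact: sqr_ge0.
move=> /allP sum0.
have rho0 i j : rho i j (Z i j) = 0.
  have := sum0 i (mem_index_enum i); rewrite /= psumr_eq0 => [|k _];
    last exact: sqr_ge0.
  by move=> /allP/(_ j (mem_index_enum j)); rewrite /= sqrf_eq0 => /eqP.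
exists Z; split=> // i j Eij; have := rho0 i j; rewrite /rho.
  by rewrite Eij => /subr0_eq.
by rewrite (negbTE Eij).
Qed.

(** Without penalty off E, the matrix G of residuals is itself supported on E, hence
is one of the test matrices. *)
Lemma psd_completion (E : rel 'I_N) Y :
  symmetric E -> reflexive E -> Y \is symmetricmx ->
  (forall C, (@psd_cone R N `&` sparse_mx E) C -> 0 <= mxinner C Y) ->
  exists2 Z, psd_cone Z & forall i j, E i j -> Z i j = Y i j.
Proof.
move=> Es Er Ys test.
have [||Z [Zpsd ZY _]] := @penalized_completion E (fun=> 0) Y Es Er Ys residual_zero.
- by move=> z; rewrite mul0r expr0n.
- move=> G Gpsd G0; have Gsym := Gpsd.1; apply: test.
  split; last exact: mask_sparse.
  suff -> : mask E G = G by [].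
  apply/matrixP => i j; rewrite mxE; case: ifPn => // /G0[_ ->//].
by exists Z.
Qed.

(** With the residual min(z, 0) off E, the entries of G there are nonpositive, so
erasing them adds a nonnegative matrix to the semidefinite G. *)
Lemma dnn_completion (E : rel 'I_N) Y :
  symmetric E -> reflexive E -> Y \is symmetricmx ->
  (forall C, (@dnn_dual_cone R N `&` sparse_mx E) C -> 0 <= mxinner C Y) ->
  (forall i j, E i j -> 0 <= Y i j) ->
  exists2 Z, dnn_cone Z & forall i j, E i j -> Z i j = Y i j.
Proof.
move=> Es Er Ys test Y0.
have [||Z [Zpsd ZY Zoff]] :=
  @penalized_completion E (fun z => Num.min z 0) Y Es Er Ys residual_neg.
- by move=> z; rewrite minEle; case: ifP => _; rewrite ?mul0r ?expr0n // expr2.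
- move=> G Gpsd G0; have Gsym := Gpsd.1; have /symmxP Gs := Gsym.
  have /symmxP Ms := (mask_sparse Es Gsym).1.
  apply: test; split; last exact: mask_sparse.
  exists G, (mask E G - G); split=> //; last by rewrite addrC subrK.
  split; last first.
    move=> i j; rewrite !mxE; case: ifPn => [_|/G0[z ->]]; first by rewrite subrr.
    by rewrite sub0r oppr_ge0 ge_min lexx orbT.
  apply/symmxP => i j.
  by rewrite mxE [RHS]mxE Ms [(- G) i j]mxE [(- G) j i]mxE Gs.
exists Z => //; split=> //; split; first exact: Zpsd.1.
move=> i j; have [Eij|/Zoff Zij] := boolP (E i j); first by rewrite ZY // Y0.
by rewrite -Zij ge_min lexx.
Qed.

Lemma dnn_dual_inner_ge0 C Z : dnn_dual_cone C -> dnn_cone Z -> 0 <= mxinner C Z.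
Proof.
move=> [P [T [Ppsd [_ T0] ->]]] [Zpsd [_ Z0]].
have -> : mxinner (P + T) Z = mxinner P Z + mxinner T Z.
  rewrite !mxinnerE -big_split; apply: eq_bigr => i _ /=.
  by rewrite -big_split; apply: eq_bigr => j _; rewrite mxE mulrDl.
apply: addr_ge0; first exact: psd_inner_ge0.
rewrite mxinnerE.
by apply: sumr_ge0 => i _; apply: sumr_ge0 => j _; rewrite mulr_ge0.
Qed.

End Completion.

(** * Comparison of the relaxations *)

Section Relaxations.
Variables (R : realType) (n m : nat) (Q : 'I_m.+1 -> 'M[R]_(1 + n)).
Hypothesis Q_sym : forall k, Q k \is symmetricmx.
Variables (X : set 'cV[R]_n) (p : nat).
Variables (B : 'I_p -> 'M[R]_(1 + n)) (b : 'I_p -> R).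
Let E := sparsity Q.
Hypothesis B_sparse : forall l, sparse_mx E (B l).

Lemma sparsity_sym : symmetric E.
Proof.
move=> i j; rewrite /E /sparsity orbCA [j == i]eq_sym; congr [|| _, _, _ | _].
by apply: eq_existsb => k; have /symmxP -> := Q_sym k.
Qed.

Lemma sparsity_refl : reflexive E.
Proof. by move=> i; rewrite /E /sparsity eqxx !orbT. Qed.

Lemma sparsity_Q k : sparse_mx E (Q k).
Proof.
split=> // i j; rewrite /E /sparsity !negb_or => /and4P[_ _ _].
by rewrite negb_exists => /forallP/(_ k); rewrite negbK => /eqP.
Qed.

(** Feasibility in the lifted problems, apart from membership in the cone, and the
objective depend only on the entries in the sparsity pattern. *)
Lemma zlift_le (K1 K2 : set 'M[R]_(1 + n)) :
  (forall Y, Y \is symmetricmx -> X (dlsubmx Y) -> K1 Y ->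
    exists Z, [/\ Z \is symmetricmx, forall i j, E i j -> Z i j = Y i j & K2 Z]) ->
  (zlift Q X B b K2 <= zlift Q X B b K1)%E.
Proof.
move=> K12; apply: le_ereal_inf_tmp => _ [Y [[Ys Y00 XY BY] QY KY] <-].
have [Z [Zs ZY KZ]] := K12 _ Ys XY KY.
apply: ereal_inf_lbound; exists Z; last first.
  by congr EFin; exact: mxinner_agree (sparsity_Q _) ZY.
split=> // [|k k0].
  split=> //.
  - by rewrite ZY // sparsity_refl.
  - suff -> : dlsubmx Z = dlsubmx Y by [].
    apply/matrixP => i j; rewrite !mxE ZY // /E /sparsity.
    by apply/orP; right; rewrite (ord1 j); apply/orP; left; apply/eqP/val_inj.
  - by move=> l; rewrite (mxinner_agree (B_sparse l) ZY).
by rewrite (mxinner_agree (sparsity_Q k) ZY) QY.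
Qed.

Lemma zDNN_eq_zDNNE : zDNN Q X B b = zDNNE Q X B b.
Proof.
apply/eqP; rewrite eq_le; apply/andP; split; apply: zlift_le => Y Ys _.
  move=> [test Y0 _].
  have [Z Zdnn ZY] := dnn_completion sparsity_sym sparsity_refl Ys test Y0.
  by exists Z; split=> //; exact: Zdnn.1.1.
move=> Ydnn; exists (mask E Y).
split; [exact: (mask_sparse sparsity_sym Ys).1|exact: mask_agree|].
split.
- by move=> C [CD CE];
    rewrite (mxinner_agree CE (@mask_agree _ _ E Y)) dnn_dual_inner_ge0.
- by move=> i j Eij; rewrite mask_agree //; exact: Ydnn.2.2.
- exact: (mask_sparse sparsity_sym Ys).2.
Qed.

Lemma zSDPE_eq_zSDP : zSDPE Q X B b = zSDP Q X B b.
Proof.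
apply/eqP; rewrite eq_le; apply/andP; split; apply: zlift_le => Y Ys _.
  move=> Ypsd; exists (mask E Y).
  split; [exact: (mask_sparse sparsity_sym Ys).1|exact: mask_agree|].
  split; last exact: (mask_sparse sparsity_sym Ys).2.
  by move=> C [Cpsd CE];
    rewrite (mxinner_agree CE (@mask_agree _ _ E Y)) psd_inner_ge0.
move=> [test _].
have [Z Zpsd ZY] := psd_completion sparsity_sym sparsity_refl Ys test.
by exists Z; split=> //; exact: Zpsd.1.
Qed.

Lemma zSDPE_le_zDNNE : (zSDPE Q X B b <= zDNNE Q X B b)%E.
Proof.
apply: zlift_le => Y Ys _ [test _ Yoff]; exists Y; split=> //; split=> //.
move=> C [Cpsd CE]; apply: test; split=> //.
exists C, 0; split=> //; last by rewrite addr0.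
by split=> [|i j]; [apply/symmxP => i j; rewrite !mxE|rewrite mxE].
Qed.

End Relaxations.

(** * Lifting the original problem *)

Section Original.
Variables (R : realType) (n m : nat).
Variables (Qbar : 'I_m.+1 -> 'M[R]_n) (c : 'I_m.+1 -> 'cV[R]_n) (d : 'I_m.+1 -> R).
Hypothesis Qbar_sym : forall k, Qbar k \is symmetricmx.

Lemma homQ_sym k : homQ Qbar c d k \is symmetricmx.
Proof.
have /symmxP Qs := Qbar_sym k.
have QT : (Qbar k)^T = Qbar k by apply/matrixP => i j; rewrite mxE.
have QQ : (homQ Qbar c d k)^T = homQ Qbar c d k.
  by rewrite /homQ tr_block_mx tr_scalar_mx !linearZ /= trmxK QT.
by apply/symmxP => i j; rewrite -[in LHS]QQ mxE.
Qed.

Lemma homQ_rank1 k x : mxinner (homQ Qbar c d k) (rank1_lift x) = quad Qbar c d k x.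
Proof.
rewrite /rank1_lift mxinner_rank1 /bilin /homQ /quad tr_col_mx tr_scalar_mx.
rewrite mul_row_block mul_row_col !mul1mx mulmx1 mulmxDl -scalemxAr -!scalemxAl.
have -> : x^T *m c k = (c k)^T *m x.
  by rewrite -[LHS]trmxK trmx_mul trmxK; apply/matrixP => i j; rewrite mxE !ord1.
by rewrite !mxE eqxx mulr1n; field.
Qed.

Lemma rank1_lift_psd (x : 'cV[R]_n) : psd_cone (rank1_lift x).
Proof. exact: psd_rank1. Qed.

Lemma rank1_lift_nonneg (x : 'cV[R]_n) : (forall i, 0 <= x i 0) ->
  nonneg_cone (rank1_lift x).
Proof.
move=> x0; have v0 i : 0 <= (col_mx 1%:M x : 'cV[R]_(1 + n)) i 0.
  case: (fintype.split_ordP i) => j ->; first by rewrite col_mxEu mxE ord1 ler01.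
  by rewrite col_mxEd.
split=> [|i j]; first exact: (rank1_lift_psd x).1.
by rewrite mxE big_ord1 [X in _ * X]mxE mulr_ge0.
Qed.

Lemma zDNN_le_zQP (X : set 'cV[R]_n) (p : nat) (B : 'I_p -> 'M[R]_(1 + n))
    (b : 'I_p -> R) :
  (forall x : 'cV[R]_n, X x -> forall i, 0 <= x i 0) ->
  (forall x, qp_feasible Qbar c d X x ->
     forall l, mxinner (B l) (rank1_lift x) <= b l) ->
  (zDNN (homQ Qbar c d) X B b <= zQP Qbar c d X)%E.
Proof.
move=> X0 Bx; apply: le_ereal_inf_tmp => _ [x xfeas <-].
have [Xx Qx] := xfeas.
apply: ereal_inf_lbound; exists (rank1_lift x); last by rewrite homQ_rank1.
split; last by split; [exact: rank1_lift_psd|exact/rank1_lift_nonneg/X0].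
  split; last exact: Bx.
  - exact: (rank1_lift_psd x).1.
  - have -> : ord0 = lshift n (ord0 : 'I_1) by exact: val_inj.
    by rewrite mxE big_ord1 [X in _ * X]mxE !col_mxEu !mxE mulr1.
  - suff -> : dlsubmx (rank1_lift x) = x by [].
    apply/matrixP => i j; rewrite mxE [LHS]mxE mxE big_ord1.
    rewrite [X in _ * X]mxE col_mxEd col_mxEu.
    by rewrite mxE !ord1 eqxx mulr1.
by move=> k k0; rewrite homQ_rank1 Qx.
Qed.

End Original.

Theorem mainTheorem4 (R : realType) (n m : nat)
    (Qbar : 'I_m.+1 -> 'M[R]_n) (c : 'I_m.+1 -> 'cV[R]_n) (d : 'I_m.+1 -> R)
    (X : set 'cV[R]_n)
    (p : nat) (B : 'I_p -> 'M[R]_(1 + n)) (b : 'I_p -> R)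
    (Qbar_sym : forall k, Qbar k \is symmetricmx)
    (X_ge0 : forall x : 'cV[R]_n, X x -> forall i, 0 <= x i 0)
    (B_sparse : forall l, sparse_mx (sparsity (homQ Qbar c d)) (B l))
    (B_valid : forall x, qp_feasible Qbar c d X x ->
       forall l, mxinner (B l) (rank1_lift x) <= b l) :
  [/\ (zDNN (homQ Qbar c d) X B b <= zQP Qbar c d X)%E,
      zDNN (homQ Qbar c d) X B b = zDNNE (homQ Qbar c d) X B b,
      (zSDPE (homQ Qbar c d) X B b <= zDNNE (homQ Qbar c d) X B b)%E
    & zSDPE (homQ Qbar c d) X B b = zSDP (homQ Qbar c d) X B b].
Proof.
have Qs := homQ_sym c d Qbar_sym.
split; [exact: zDNN_le_zQP|exact: zDNN_eq_zDNNE| |exact: zSDPE_eq_zSDP].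
exact: zSDPE_le_zDNNE.
Qed.
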